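(* Let $\sigma$ be a partition of the set of all primes and let $G\neq 1$ be a finite group. Then the following statements are equivalent: (1) $G$ has a normal series $1=G_1<G_2<\cdots<G_{t-1}<G_t=G$ (each $G_i$ normal in $G$) such that for every $i=2,\ldots,t$ there is some $\sigma_k\in\sigma(G)$ (depending on $i$) for which $G_i/G_{i-1}$ is a $\sigma_k$-group and both $G_{i-1}$ and $G/G_i$ are $\sigma_k'$-groups; (2) the $\sigma$-Hawkes graph $\Gamma_{H\sigma}(G)$ has no circuits; (3) $G$ is $\sigma$-soluble and the $\sigma$-Vasil'ev-Murashko graph $\Gamma_{\mathfrak{N}_\sigma}(G)$ has no circuits.
   Context: All groups are finite. $\mathbb{P}$ is the set of all primes, $\pi(n)$ is the set of primes dividing the integer $n$, and $\pi(G)=\pi(|G|)$. $\sigma=\{\sigma_i\mid i\in I\}$ is a partition of $\mathbb{P}$: $\mathbb{P}=\bigcup_{i\in I}\sigma_i$ and $\sigma_i\cap\sigma_j=\emptyset$ for $i\ne j$. Put $\sigma(n)=\{\sigma_i\mid \sigma_i\cap\pi(n)\neq\emptyset\}$ and $\sigma(G)=\sigma(|G|)$. For a set of primes $\pi$, a $\pi$-group is a group $X$ with $\pi(X)\subseteq\pi$, and $\pi'=\mathbb{P}\setminus\pi$. A chief factor $H/K$ of $G$ is $\sigma$-central in $G$ if for some $i$ both $H/K$ and $G/C_G(H/K)$ are $\sigma_i$-groups. $G$ is: $\sigma$-soluble if every chief factor of $G$ is a $\sigma_i$-group for some $i$ (depending on the factor); $\sigma$-nilpotent if every chief factor of $G$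 is $\sigma$-central in $G$; $\{\sigma_i\}$-nilpotent if every chief factor $H/K$ of $G$ with $\pi(H/K)\cap\sigma_i\neq\emptyset$ is $\sigma$-central in $G$. $F_{\{\sigma_i\}}(G)$ is the largest normal $\{\sigma_i\}$-nilpotent subgroup of $G$. $\mathfrak{N}_\sigma$ is the class of all $\sigma$-nilpotent groups; an $\mathfrak{N}_\sigma$-critical group is a non-$\sigma$-nilpotent group all of whose proper subgroups are $\sigma$-nilpotent. Both graphs are directed graphs with vertex set $\sigma(G)$. In $\Gamma_{H\sigma}(G)$, $(\sigma_i,\sigma_j)$ is an edge iff $\sigma_j\in\sigma(G/F_{\{\sigma_i\}}(G))$. In $\Gamma_{\mathfrak{N}_\sigma}(G)$, $(\sigma_i,\sigma_j)$ is an edge iff for some $\mathfrak{N}_\sigma$-critical subgroup $H$ of $G$ we have $\sigma_i\in\sigma(H)$ and $\sigma_j\in\sigma(H/F_{\{\sigma_i\}}(H))$. A circuit is a directed closed path; a loop $(\sigma_i,\sigma_i)$ counts as a circuit. *)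

(* Defs.v *)
From mathcomp Require Import all_boot all_fingroup all_solvable.

Set Implicit Arguments.
Unset Strict Implicit.
Unset Printing Implicit Defensive.

Local Open Scope group_scope.

Definition prime_partition (I : Type) (sigma : I -> nat_pred) : Prop :=
  [/\ forall i p, p \in sigma i -> prime p,
      forall p, prime p -> exists i, p \in sigma i
    & forall i j p, p \in sigma i -> p \in sigma j -> i = j].

Section SigmaGroups.

Variables (I : Type) (sigma : I -> nat_pred).

(* [in_sigma n i] is sigma_i \in sigma(n). Blocks are handled through their
   indices; this is harmless since distinct nonempty blocks have distinct
   indices and conversely, and a block meeting \pi(n) is nonempty. *)
Definition in_sigma (n : nat) (i : I) : Prop :=
  exists2 p, p \in \pi(n) & p \in sigma i.

Variable gT : finGroupType.
Implicit Types G H K F N : {group gT}.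

(* In [chief_factor G K H] the lower term K comes first; 'C_G(H / K | 'Q) is
   the centraliser in G of H / K under the conjugation action. *)
Definition sigma_central G K H : Prop :=
  exists i, (sigma i).-group (H / K)
         /\ (sigma i).-group (G / 'C_G(H / K | 'Q)).

Definition sigma_soluble G : Prop :=
  forall K H, chief_factor G K H -> exists i, (sigma i).-group (H / K).

Definition sigma_nilpotent G : Prop :=
  forall K H, chief_factor G K H -> sigma_central G K H.

Definition block_nilpotent (i : I) G : Prop :=
  forall K H, chief_factor G K H -> in_sigma #|H / K| i ->
  sigma_central G K H.

(* F = F_{sigma_i}(G). It is unique by antisymmetry of inclusion, and it
   exists whenever sigma is a partition of the primes: {sigma_i}-nilpotency
   then means having a normal Hall sigma_i^'-subgroup, a property inherited
   by products of normal subgroups. *)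
Definition is_block_Fitting (i : I) G F : Prop :=
  [/\ F <| G, block_nilpotent i F
    & forall N, N <| G -> block_nilpotent i N -> N \subset F].

Definition sigma_nilpotent_critical G : Prop :=
  ~ sigma_nilpotent G /\ (forall H, H \proper G -> sigma_nilpotent H).

Definition Hawkes_edge G (i j : I) : Prop :=
  [/\ in_sigma #|G| i, in_sigma #|G| j
    & exists2 F, is_block_Fitting i G F & in_sigma #|G / F| j].

Definition Vasilev_Murashko_edge G (i j : I) : Prop :=
  [/\ in_sigma #|G| i, in_sigma #|G| j
    & exists H, [/\ H \subset G, sigma_nilpotent_critical H, in_sigma #|H| i
    & exists2 F, is_block_Fitting i H F & in_sigma #|H / F| j]].

Definition has_sigma_series G : Prop :=
  exists (t : nat) (S : nat -> {group gT}),
  [/\ 1 <= t, S 1%N :=: 1, S t :=: G,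
      forall i, 1 <= i <= t -> S i <| G
    & forall i, 2 <= i <= t ->
      S i.-1 \proper S i
      /\ exists k, [/\ in_sigma #|G| k, (sigma k).-group (S i / S i.-1),
                       (sigma k)^'.-group (S i.-1)
                     & (sigma k)^'.-group (G / S i)]].

End SigmaGroups.

(* A closed walk of positive length n; n = 1 is a loop. *)
Definition has_circuit (V : Type) (E : V -> V -> Prop) : Prop :=
  exists (n : nat) (v : nat -> V),
  [/\ 0 < n, v n = v 0 & forall k, k < n -> E (v k) (v k.+1)].

(* Main.v *)
(* Write pi = sigma_k. By Schur-Zassenhaus, {sigma_k}-nilpotent means having a
   normal Hall pi'-subgroup, so F_{sigma_k}(G) = O_{pi',pi}(G). A block k with no
   outgoing Hawkes edge is one for which G itself is {sigma_k}-nilpotent; a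
   graph without circuits has such a sink, and passing to O_{pi'}(G) builds the
   series from the top. Conversely the top block of a series is a sink, so every
   circuit already lives in the next lower term. Since H :&: F_{sigma_k}(G) is
   contained in F_{sigma_k}(H), every Vasil'ev-Murashko edge is a Hawkes edge.
   From the third condition back to the first: if k is a sink of the
   Vasil'ev-Murashko graph then all critical subgroups of G are
   {sigma_k}-nilpotent, and a sigma-soluble G with this property is
   {sigma_k}-nilpotent: a minimal counterexample has the form P ><| B with P a
   sigma_k-group and B a sigma_j-group, hence is critical. *)
Require Import Defs.
From mathcomp Require Import all_boot all_fingroup all_solvable.
From Stdlib Require Import Classical.

Set Implicit Arguments.
Unset Strict Implicit.
Unset Printing Implicit Defensive.

Local Open Scope group_scope.

(** * Divisibility of indices, and chief factors *)

Section Index.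

Variable gT : finGroupType.
Implicit Types A X Y Z G H K N Q U V : {group gT}.

(** Since [#|X : Y|] equals [#|X : X :&: Y|], neither [Y] nor [Z] has to lie in [X]; pi-number
    bounds on indices thus pass to intersections without naming them. *)
Lemma index_dvdn_capl X Y Z : X :&: Z \subset Y -> #|X : Y| %| #|X : Z|.
Proof.
move=> sXZY; rewrite -indexgI -(indexgI X Z).
rewrite -(Lagrange_index (subsetIl X Y) (_ : X :&: Z \subset X :&: Y)).
  exact: dvdn_mulr.
by rewrite subsetI subsetIl.
Qed.

Lemma index_dvdn_sub X G Z : X \subset G -> Z <| G -> #|X : Z| %| #|G : Z|.
Proof.
move=> sXG /andP[_ nZG]; rewrite -!card_quotient ?(subset_trans sXG) //.
by rewrite cardSg ?quotientS.
Qed.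

Lemma chief_factorP G V U :
  reflect [/\ V <| G, U <| G, V \proper U
            & forall N, N <| G -> V \subset N -> N \subset U -> N :=: V \/ N :=: U]
          (chief_factor G V U).
Proof.
apply: (iffP andP) => [[/maxgroupP[/andP[pVU nVG] maxV] nUG] | ].
  have sUG := normal_sub nUG.
  split=> //; first by rewrite /normal nVG (subset_trans (proper_sub pVU)).
  move=> N /andP[_ nNG] sVN sNU.
  have [-> | neNU] := eqVneq N U; [by right | left].
  by apply: maxV; rewrite // properEneq neNU sNU.
case=> /andP[_ nVG] nUG pVU minUV; split=> //.
apply/maxgroupP; split; first by rewrite pVU.
move=> N /andP[pNU nNG] sVN.
have nsNG: N <| G.
  by rewrite /normal nNG (subset_trans (proper_sub pNU)) ?normal_sub.
by case: (minUV N nsNG sVN (proper_sub pNU)) => // eNU; rewrite eNU properxx in pNU.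
Qed.

Lemma chief_factor_above G V :
  V <| G -> V \proper G -> exists U, chief_factor G V U.
Proof.
move=> nVG pVG.
have : [exists U : {group gT}, (U <| G) && (V \proper U)].
  by apply/existsP; exists G; rewrite normal_refl.
case/existsP=> U0 pU0.
case: (@mingroup_exists gT (fun U => (U <| G) && (V \proper U)) U0 pU0) => U.
case/mingroupP=> /andP[nUG pVU] minU _; exists U; apply/chief_factorP.
split=> // N nNG sVN sNU.
have [-> | neNV] := eqVneq N V; [by left | right].
by apply: minU => //; rewrite nNG properEneq eq_sym neNV.
Qed.

(* The dichotomy is that (U :&: Q)V lies between V and U. *)
Lemma chief_factor_cap G V U Q :
  chief_factor G V U -> Q <| G ->
  U :&: Q \subset V \/ U \subset V * (U :&: Q).
Proof.
case/chief_factorP=> nVG nUG pVU minUV nQG.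
have nUQ: U :&: Q <| G by rewrite normalI.
have nVUQ: V \subset 'N(U :&: Q).
  by rewrite (subset_trans (normal_sub nVG)) ?normal_norm.
case: (minUV (V <*> (U :&: Q))%G).
- by rewrite normalY.
- exact: joing_subl.
- by rewrite join_subG proper_sub // subsetIl.
- by move=> /= <-; left; exact: joing_subr.
by move=> /= defU; right; rewrite -norm_joinEl ?defU.
Qed.

End Index.

(** * Groups with a normal Hall pi'-subgroup *)

Section PiNilpotent.

Variable pi : nat_pred.
Variable gT : finGroupType.
Implicit Types G H K L N Q R U V F : {group gT}.

Definition pi_nilpotent G := pi.-nat #|G : 'O_pi^'(G)|.

Lemma pi_nilpotentP G :
  reflect (exists Q, [/\ Q <| G, pi^'.-group Q & pi.-nat #|G : Q|])
          (pi_nilpotent G).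
Proof.
apply: (iffP idP) => [nilG | [Q [nQG pi'Q piGQ]]].
  by exists 'O_pi^'(G)%G; rewrite pcore_normal pcore_pgroup.
apply: pnat_dvd piGQ; apply: indexgS; exact: pcore_max.
Qed.

Lemma pi_nilpotentS G H : H \subset G -> pi_nilpotent G -> pi_nilpotent H.
Proof.
move=> sHG /pi_nilpotentP[Q [nQG pi'Q piGQ]].
apply/pi_nilpotentP; exists (H :&: Q)%G; split.
- exact: (normalGI sHG nQG).
- by apply: pgroupS pi'Q; apply: subsetIr.
by rewrite indexgI; apply: pnat_dvd piGQ; apply: index_dvdn_sub.
Qed.

(** The product of [R] and O_{pi'}(L) is a pi'-group normalised by [R] and by [L], and its index in
    [G] divides that of O_{pi'}(L) in [L]. In a minimal counterexample this rules out proper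
    supplements of [R]. *)
Lemma pi_nilpotent_pi'mul G R L :
  R <| G -> pi^'.-group R -> R * L = G -> pi_nilpotent L -> pi_nilpotent G.
Proof.
move=> nRG pi'R defG nilL; set O := 'O_pi^'(L)%G.
have sLG: L \subset G by rewrite -defG mulG_subr.
have sOL: O \subset L by exact: pcore_sub.
have nRO: O \subset 'N(R).
  exact: subset_trans (subset_trans sOL sLG) (normal_norm nRG).
have sEG: R <*> O \subset G.
  by rewrite join_subG normal_sub // (subset_trans sOL).
apply/pi_nilpotentP; exists (R <*> O)%G; split.
- rewrite /normal sEG -{1}defG mul_subG ?(subset_trans (joing_subl R O)) ?normG //.
  by apply: normsY; [rewrite (subset_trans sLG) ?normal_norm | exact: gFnorm].
- by rewrite /= norm_joinEr // pgroupM pi'R pcore_pgroup.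
have -> : #|G : (R <*> O)%G| = #|L : (R <*> O)%G|.
  rewrite -[RHS](indexMg (R <*> O)%G L); congr #|_ : _|.
  apply/eqP; rewrite eqEsubset mul_subG // andbT.
  by rewrite -{1}defG mulSg ?joing_subl.
apply: pnat_dvd nilL; apply: index_dvdn_capl.
by apply: subset_trans (subsetIr _ _) (joing_subr _ _).
Qed.

Lemma pseries_pi_nilpotent G : pi_nilpotent 'O_{pi^', pi}(G)%G.
Proof.
apply/pi_nilpotentP; exists 'O_pi^'(G)%G; split; last 1 first.
- rewrite -card_quotient ?quotient_pseries2; first exact: pcore_pgroup.
  by apply: (subset_trans (pseries_sub _ _)); exact: gFnorm.
- apply: (normalS _ (pseries_sub [:: pi^'; pi]%SEQ G)); last exact: pcore_normal.
  by rewrite /= -pseries1; apply: (pseries_sub_catl [:: pi^']%SEQ).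
exact: pcore_pgroup.
Qed.

(** O_{pi'}(N) is characteristic in [N], hence lies in O_{pi'}(G), so the image of [N] modulo
    O_{pi'}(G) is a normal pi-group. With the preceding lemma, O_{pi',pi}(G) is the largest normal
    pi-nilpotent subgroup. *)
Lemma pi_nilpotent_sub_pseries G N :
  N <| G -> pi_nilpotent N -> N \subset 'O_{pi^', pi}(G).
Proof.
move=> nNG nilN; have nOG : G \subset 'N('O_pi^'(G)) by exact: gFnorm.
have nON := subset_trans (normal_sub nNG) nOG.
rewrite -(quotientSGK nON) ?quotient_pseries2; last first.
  by rewrite /= -pseries1; apply: (pseries_sub_catl [:: pi^']%SEQ).
apply: pcore_max; last exact: quotient_normal.
rewrite /pgroup card_quotient //; apply: pnat_dvd nilN; apply: index_dvdn_capl.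
apply: subset_trans (subsetIr _ _) _; apply: pcore_max; first exact: pcore_pgroup.
exact: gFnormal_trans.
Qed.

End PiNilpotent.

Lemma normal_centQ gT (G N U : {group gT}) :
  N <| G -> U <| G -> 'C_G(U / N | 'Q) <| G.
Proof.
move=> nNG nUG; rewrite /normal subsetIl normsI ?normG //.
apply: subset_trans (astab_norm _ _).
by apply: actsQ; exact: normal_norm.
Qed.

(* A Schur-Zassenhaus complement of U in M centralises U, hence is normal. *)
Lemma centralised_Hall_pi_nilpotent pi gT (G M U : {group gT}) :
    U <| G -> M <| G -> U \subset M -> pi.-group U -> pi^'.-nat #|M : U| ->
  pi.-nat #|G : 'C_G(U)| -> pi_nilpotent pi M.
Proof.
move=> nUG nMG sUM piU pi'M piC; have sMG := normal_sub nMG.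
have nUM : U <| M by apply: normalS nUG.
have hU : Hall M U by rewrite /Hall sUM (pnat_coprime piU).
have /splitsP[Q /complP[tiUQ defM]] := SchurZassenhaus_split hU nUM.
have sQM : Q \subset M by rewrite -defM mulG_subr.
have cM : #|M| = (#|U| * #|Q|)%N by rewrite -defM TI_cardMg.
have pi'Q : pi^'.-group Q.
  by rewrite /pgroup -(mulKn #|Q| (cardG_gt0 U)) -cM divgS.
have nCG : 'C_G(U) <| G.
  by rewrite -{2}(setIidPl (normal_norm nUG)) subcent_normal.
have sQC : Q \subset 'C(U).
  suff: Q \subset 'C_G(U) by rewrite subsetI => /andP[].
  (* The index of C_G(U) in [Q] divides both the pi-number |G : C_G(U)| and the pi'-number |Q|. *)
  rewrite -indexg_eq1; apply/eqP; apply: (@pnat_1 pi).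
    by apply: pnat_dvd piC; apply: index_dvdn_sub nCG; apply: subset_trans sMG.
  by apply: pnat_dvd pi'Q; exact: dvdn_indexg.
apply/pi_nilpotentP; exists Q; split=> //.
  rewrite /normal sQM -defM mul_subG ?normG //.
  by rewrite (subset_trans _ (cent_sub _)) // centsC.
by rewrite -divgS // cM mulnK.
Qed.

(** * Chief factors against normal Hall subgroups, and comparison of edges *)

Section BlockNilpotent.

Variables (I : Type) (sigma : I -> nat_pred).
Hypothesis sigmaP : prime_partition sigma.

Lemma sigma_inj i j p : p \in sigma i -> p \in sigma j -> i = j.
Proof. by case: sigmaP => _ _; apply. Qed.

Lemma sigma_cover p : prime p -> exists i, p \in sigma i.
Proof. by case: sigmaP => _ + _; apply. Qed.

Lemma in_sigma_dvd m n i :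
  m %| n -> 0 < n -> in_sigma sigma m i -> in_sigma sigma n i.
Proof. by move=> dv n0 [p pm ps]; exists p => //; exact: pi_of_dvd pm. Qed.

Lemma in_sigma_pnat n i j : (sigma i).-nat n -> in_sigma sigma n j -> j = i.
Proof. by move=> in_n [p /(pnatPpi in_n) pi pj]; exact: sigma_inj pj pi. Qed.

Lemma pnat_in_sigma n i : 0 < n -> ~ in_sigma sigma n i -> (sigma i)^'.-nat n.
Proof.
move=> n0 Nin; apply/pnatP=> // p p_pr pn; apply/negP=> pi; apply: Nin.
by exists p; rewrite ?mem_primes ?p_pr ?n0.
Qed.

Lemma sigma_pnatC i j n : i <> j -> (sigma i).-nat n -> (sigma j)^'.-nat n.
Proof.
move=> neq_ij; apply: sub_in_pnat => p _ pi; apply/negP=> pj.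
exact/neq_ij/(sigma_inj pi pj).
Qed.

Lemma in_sigma_mul m n i :
  in_sigma sigma (m * n)%N i -> in_sigma sigma m i \/ in_sigma sigma n i.
Proof.
case=> p; rewrite mem_primes muln_gt0 => /and3P[p_pr /andP[m0 n0]].
rewrite Euclid_dvdM // => /orP[pm | pn] pi; [left | right];
by exists p; rewrite ?mem_primes ?p_pr ?m0 ?n0.
Qed.



Variable gT : finGroupType.
Implicit Types G H K N M U V Q F : {group gT}.

(** Induction on |G : N| through a chief factor U/N, starting from the [M] found above [U]. If U/N
    is a sigma_i'-group, the same [M] serves; otherwise centrality makes U/N a Hall subgroup of M/N
    with centraliser of sigma_i-index, and the preimage of O_{sigma_i'}(M/N) serves. The case N = 1
    is the goal. *)
Lemma block_nilpotent_above i G N :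
  block_nilpotent sigma i G -> N <| G ->
  exists M, [/\ M <| G, N \subset M, (sigma i).-nat #|G : M|
              & (sigma i)^'.-nat #|M : N|].
Proof.
move=> nilG; have [n] := ubnP #|G : N|; elim: n N => // n IHn N lt_n nNG.
have [pNG | ] := boolP (N \proper G); last first.
  rewrite properEneq normal_sub // andbT negbK => /eqP/val_inj->.
  by exists G; rewrite indexgg.
have [U cfU] := chief_factor_above nNG pNG.
have [_ nUG pNU _] := chief_factorP _ _ _ cfU.
have [sNU sUG] := (proper_sub pNU, normal_sub nUG).
have ltU : #|G : U| < #|G : N|.
  rewrite -(Lagrange_index sUG sNU) -[X in X < _]muln1 ltn_pmul2l //.
  by rewrite indexg_gt1; case/andP: pNU.
case: (IHn U (leq_trans ltU lt_n) nUG) => M [nMG sUM piGM pi'MU].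
have [sNM sMG] := (subset_trans sNU sUM, normal_sub nMG).
have [pi'U | ] := classic ((sigma i)^'.-nat #|U : N|).
  by exists M; rewrite -(Lagrange_index sUM sNU) pnatM pi'MU.
move=> Npi'U; have cUN : #|U / N| = #|U : N|.
  by rewrite card_quotient // (subset_trans sUG) ?normal_norm.
have inU : in_sigma sigma #|U / N| i.
  by apply: NNPP => /(pnat_in_sigma (cardG_gt0 _)); rewrite cUN.
have [k [piU piC]] := nilG _ _ cfU inU.
have eik := in_sigma_pnat piU inU; rewrite -{k}eik in piU piC.
have nCG : 'C_G(U / N | 'Q) \subset G by exact: subsetIl.
have nNGn := normal_norm nNG.
have iN (X Y : {group gT}) : X \subset G -> N \subset Y -> Y \subset X ->
   #|X / N : Y / N| = #|X : Y|.
  move=> sXG sNY sYX; rewrite index_quotient_eq // ?(subset_trans sXG) //.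
  exact: subset_trans (subsetIr _ _) sNY.
have sNC : N \subset 'C_G(U / N | 'Q).
  rewrite subsetI normal_sub //= sub_astabQ normG /=.
  by rewrite trivg_quotient sub1G.
have piCb : (sigma i).-nat #|G / N : 'C_(G / N)(U / N)|.
  have <- : 'C_G(U / N | 'Q) / N = 'C_(G / N)(U / N).
    by rewrite quotientGI ?normal_sub // quotient_astabQ.
  rewrite (iN G 'C_G(U / N | 'Q)%G) //.
  by rewrite -card_quotient ?normal_norm ?normal_centQ.
have nUMb : pi_nilpotent (sigma i) (M / N)%G.
  apply: (@centralised_Hall_pi_nilpotent _ _ (G / N)%G _ (U / N)%G) => //=.
  - exact: quotient_normal.
  - exact: quotient_normal.
  - exact: quotientS.
  - by rewrite (iN M U).
have nOG : 'O_(sigma i)^'(M / N) <| G / N.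
  by apply: gFnormal_trans; exact: quotient_normal.
have [Q defQ sNQ nQG] := inv_quotientN nNG nOG.
have sQM : Q \subset M.
  rewrite -(quotientSGK _ sNM) -?defQ ?pcore_sub //.
  exact: subset_trans (normal_sub nQG) nNGn.
exists Q; split=> //.
  rewrite -(Lagrange_index sMG sQM) pnatM piGM /= -(iN M Q) //.
  by rewrite -[Q / N]defQ.
rewrite -card_quotient ?(subset_trans (normal_sub nQG)) // -defQ.
exact: pcore_pgroup.
Qed.

(** For the converse, a chief factor U/V meeting sigma_i cannot be covered by the normal Hall
    sigma_i'-subgroup [Q]. So U :&: Q lies in [V], hence [U, Q] does too, [Q] centralises U/V, and
    both orders required to be sigma_i-numbers divide |G : Q|. *)
Lemma block_nilpotentP i G :
  block_nilpotent sigma i G <-> pi_nilpotent (sigma i) G.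
Proof.
split=> [nilG | nilG V U cfU inU].
  have [M [nMG _ piGM pi'M]] := block_nilpotent_above nilG (normal1 G).
  by apply/pi_nilpotentP; exists M; rewrite /pgroup -indexg1.
have [Q [nQG pi'Q piGQ]] := pi_nilpotentP _ _ nilG.
have [nVG nUG pVU _] := chief_factorP _ _ _ cfU.
have [sVU sUG] := (proper_sub pVU, normal_sub nUG).
have nVU : U \subset 'N(V) := subset_trans sUG (normal_norm nVG).
have nVQ : Q \subset 'N(V) := subset_trans (normal_sub nQG) (normal_norm nVG).
have sUQV : U :&: Q \subset V.
  case: (chief_factor_cap cfU nQG) => // sUV.
  have [p pU pi] := inU; have: (sigma i)^'.-nat #|U / V|.
    rewrite card_quotient //; apply: pnat_dvd pi'Q.
    have -> : #|U : V| = #|U :&: Q : V|.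
      rewrite -(indexMg V (U :&: Q)); congr #|_ : _|; apply/eqP.
      by rewrite eqEsubset sUV mul_subG ?subsetIl.
    by apply: (dvdn_trans (dvdn_indexg _ _)); rewrite cardSg ?subsetIr.
  by move/pnatPpi/(_ pU); rewrite inE /= pi.
exists i; rewrite /pgroup card_quotient // card_quotient; last first.
  by rewrite normal_norm ?normal_centQ.
split.
  apply: pnat_dvd (pnat_dvd (index_dvdn_sub sUG nQG) piGQ).
  exact: index_dvdn_capl.
apply: pnat_dvd piGQ; apply: indexgS; rewrite subsetI normal_sub //=.
rewrite sub_astabQR //; apply: subset_trans sUQV.
rewrite subsetI commg_subr commg_subl (subset_trans sUG (normal_norm nQG)) andbT.
exact: subset_trans (normal_sub nQG) (normal_norm nUG).
Qed.

Lemma sigma_nilpotentP G :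
  (forall p, p \in \pi(G) -> exists2 i, p \in sigma i & pi_nilpotent (sigma i) G) ->
  sigma_nilpotent sigma G.
Proof.
move=> nilG V U cfU; have [nVG nUG pVU _] := chief_factorP _ _ _ cfU.
have nVU : U \subset 'N(V) := subset_trans (normal_sub nUG) (normal_norm nVG).
have : 1 < #|U / V| by rewrite card_quotient // indexg_gt1; case/andP: pVU.
rewrite -pi_pdiv => pU; have [| i pi nil_i] := nilG (pdiv #|U / V|).
  apply: (pi_of_dvd _ (cardG_gt0 G) pU); rewrite card_quotient //.
  exact: dvdn_trans (dvdn_indexg _ _) (cardSg (normal_sub nUG)).
by apply: (block_nilpotentP i G).2 cfU _ => //; exists (pdiv #|U / V|).
Qed.

Lemma block_Fitting_exists i G :
  is_block_Fitting sigma i G 'O_{(sigma i)^', sigma i}(G)%G.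
Proof.
split; first exact: pseries_normal.
  exact/block_nilpotentP/pseries_pi_nilpotent.
by move=> N nNG /block_nilpotentP; exact: pi_nilpotent_sub_pseries.
Qed.

(** Common to both comparisons of edges below: |H : F'| divides |G : F|, as H :&: F is a normal
    {sigma_i}-nilpotent subgroup of [H]. *)
Lemma block_Fitting_index i j G H F F' :
    H \subset G -> is_block_Fitting sigma i G F -> is_block_Fitting sigma i H F' ->
  in_sigma sigma #|H / F'| j -> in_sigma sigma #|G / F| j.
Proof.
move=> sHG [nFG /block_nilpotentP nilF _] [nF'H _ maxF'].
rewrite !card_quotient ?normal_norm //; apply: in_sigma_dvd => //.
apply: dvdn_trans (index_dvdn_sub sHG nFG); apply: index_dvdn_capl.
apply: (maxF' (H :&: F)%G); first exact: (normalGI sHG nFG).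
by apply/block_nilpotentP; apply: pi_nilpotentS nilF; exact: subsetIr.
Qed.

Lemma Vasilev_Murashko_Hawkes_edge i j G :
  Vasilev_Murashko_edge sigma G i j -> Hawkes_edge sigma G i j.
Proof.
case=> iG jG [H [sHG _ _ [F' fitF' jF']]]; split=> //.
exists 'O_{(sigma i)^', sigma i}(G)%G; first exact: block_Fitting_exists.
exact: block_Fitting_index sHG (block_Fitting_exists i G) fitF' jF'.
Qed.

Lemma Hawkes_edge_sub i j G H :
  H \subset G -> Hawkes_edge sigma H i j -> Hawkes_edge sigma G i j.
Proof.
move=> sHG [iH jH [F' fitF' jF']].
split; [exact: in_sigma_dvd (cardSg sHG) _ iH
       | exact: in_sigma_dvd (cardSg sHG) _ jH |].
exists 'O_{(sigma i)^', sigma i}(G)%G; first exact: block_Fitting_exists.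
exact: block_Fitting_index sHG (block_Fitting_exists i G) fitF' jF'.
Qed.

Lemma Vasilev_Murashko_edge_sub i j G H :
  H \subset G -> Vasilev_Murashko_edge sigma H i j ->
  Vasilev_Murashko_edge sigma G i j.
Proof.
move=> sHG [iH jH [K [sKH critK iK jK]]].
split; [exact: in_sigma_dvd (cardSg sHG) _ iH
       | exact: in_sigma_dvd (cardSg sHG) _ jH |].
by exists K; split=> //; exact: subset_trans sHG.
Qed.

End BlockNilpotent.

(** * A finite graph without circuits has a sink *)

Section Sinks.

Variables (I : Type) (sigma : I -> nat_pred).
Hypothesis sigmaP : prime_partition sigma.

(* Finitely many blocks meet \pi(n), so a walk of length n + 1 through them
   revisits one; each visited block is tagged by one of its primes. *)
Lemma out_edges_circuit (E : I -> I -> Prop) n i0 :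
    0 < n -> in_sigma sigma n i0 -> (forall i j, E i j -> in_sigma sigma n j) ->
  (forall i, in_sigma sigma n i -> exists j, E i j) -> has_circuit E.
Proof.
move=> n0 [p0 p0n p0i] En out.
have [v [p [vE pv]]] : exists v : nat -> I, exists p : nat -> nat,
   (forall k, k < n.+1 -> E (v k) (v k.+1))
   /\ (forall k, k <= n.+1 -> p k \in \pi(n) /\ p k \in sigma (v k)).
  elim: n.+1 => [|m [v [p [vE pv]]]].
    exists (fun=> i0), (fun=> p0); split=> // k; by [].
  have [pm vm] := pv m (leqnn m).
  have [|j Ej] := out (v m); first by exists (p m).
  have [q qn qj] := En _ _ Ej.
  exists (fun k => if k <= m then v k else j), (fun k => if k <= m then p k else q).
  split=> k; last first.
    case: ltngtP => // [|-> _]; last by rewrite ltnn.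
    by rewrite ltnS => le_km _; rewrite le_km; exact: pv.
  rewrite ltnS => le_km; rewrite le_km.
  case: ltngtP le_km => // [lt_km _ | -> _] //.
  exact: vE.
(* There are n + 2 positions, and the tags, being divisors of n, take at most n + 1 values; by
   [le_p], [inord] never returns its default. *)
pose f (k : 'I_n.+2) : 'I_n.+1 := inord (p k).
have /injectivePn[x [y neq_xy eq_f]] : ~~ injectiveb f.
  apply/negP=> /injectiveP/leq_card; by rewrite !card_ord ltnn.
have le_p (k : 'I_n.+2) : p k < n.+1.
  have /pv[] := ltn_ord k; by rewrite mem_primes ltnS => /and3P[_ _ /dvdn_leq->].
wlog lt_xy : x y neq_xy eq_f / x < y.
  move=> IH; move: (neq_xy); rewrite -val_eqE neq_ltn => /orP[lt_xy | lt_yx].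
    exact: IH lt_xy.
  by apply: (IH y x); rewrite // eq_sym.
have eq_p : p x = p y.
  by move/(congr1 val): eq_f; rewrite /= !inordK.
(* The circuit is the stretch of the walk from [x] to [y]; it closes because one prime lies in only
   one block. *)
exists (y - x)%N, (fun k => v (x + k)%N); split.
- by rewrite subn_gt0.
- rewrite addn0 subnKC ?(ltnW lt_xy) //.
  have [[_ px] [_ py]] := (pv x (ltn_ord x), pv y (ltn_ord y)).
  by apply: (sigma_inj sigmaP py); rewrite -eq_p.
move=> k; rewrite ltn_subRL => lt_k; rewrite addnS; apply: vE.
exact: leq_trans lt_k (ltn_ord y).
Qed.

Lemma no_circuit_sink (E : I -> I -> Prop) n :
    1 < n -> (forall i j, E i j -> in_sigma sigma n j) -> ~ has_circuit E ->
  exists2 i, in_sigma sigma n i & forall j, ~ E i j.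
Proof.
move=> n1 En Ncirc; apply: NNPP => Nsink; apply: Ncirc.
have [i0 pi0] := sigma_cover sigmaP (pdiv_prime n1).
apply: (out_edges_circuit (ltnW n1) (i0 := i0)) En _.
  by exists (pdiv n); rewrite ?pi_pdiv.
move=> i in_i; apply: NNPP => Nout; apply: Nsink.
by exists i => // j Eij; apply: Nout; exists j.
Qed.

End Sinks.

(** * The normal series as an inductive tower *)

Section Towers.

Variables (I : Type) (sigma : I -> nat_pred).
Hypothesis sigmaP : prime_partition sigma.
Variable gT : finGroupType.
Implicit Types G H K N M U V Q R : {group gT}.

(** A layer records coprimality only with what lies below it; the condition on the quotient above is
    recovered in [tower_series]. Terms are normal in the fixed [G], while induction runs on the top
    term. *)
Inductive sigma_tower G : {group gT} -> Prop :=
| SigmaTower1 : sigma_tower G 1%G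
| SigmaTowerS Q R k of sigma_tower G Q & Q \proper R & R <| G
    & (sigma k).-nat #|R : Q| & (sigma k)^'.-group Q : sigma_tower G R.

Lemma sigma_tower_normal G R : sigma_tower G R -> R <| G.
Proof. by case=> //; exact: normal1. Qed.

Lemma pnat_in_sigma_gt1 n i : 1 < n -> (sigma i).-nat n -> in_sigma sigma n i.
Proof.
move=> n1 in_n; exists (pdiv n); first by rewrite pi_pdiv.
by apply: pnatPpi in_n _; rewrite pi_pdiv.
Qed.

Lemma series_tower G : has_sigma_series sigma G -> sigma_tower G G.
Proof.
case=> t [S [t1 S1 St nS cS]].
suff tS i : 1 <= i <= t -> sigma_tower G (S i).
  have eSt : S t = G by exact: val_inj.
  by rewrite -{2}eSt; apply: tS; rewrite t1 leqnn.
elim: i => [|[|i] IHi] // /andP[_ le_it].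
  by have -> : S 1%N = 1%G; [exact: val_inj | exact: SigmaTower1].
have [pS [k [_ kS k'S _]]] := cS i.+2 le_it.
have nSi : S i.+1 <| G by apply: nS; exact: ltnW.
have nSii : S i.+2 <| G by exact: nS.
apply: (SigmaTowerS (IHi (ltnW le_it)) pS nSii _ k'S).
by rewrite -card_quotient // (subset_trans (normal_sub nSii)) ?normal_norm.
Qed.

Lemma tower_series G : sigma_tower G G -> has_sigma_series sigma G.
Proof.
move=> tG; suff: forall R, sigma_tower G R ->
  exists (t : nat) (S : nat -> {group gT}),
  [/\ 1 <= t, S 1%N :=: 1, S t :=: R,
      forall i, 1 <= i <= t -> S i <| G
    & forall i, 2 <= i <= t ->
      S i.-1 \proper S i
      /\ exists k, [/\ in_sigma sigma #|R| k, (sigma k).-group (S i / S i.-1),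
                       (sigma k)^'.-group (S i.-1)
                     & (sigma k)^'.-group (R / S i)]] by exact.
move=> R; elim=> [|Q {}R k0 tQ [t [S [t1 S1 St nS cS]]] pQR nRG kR k'Q].
  exists 1%N, (fun=> 1%G); split=> // [i _ | i /andP[i2 i1]]; first exact: normal1.
  by have:= leq_trans i2 i1.
have nQG := sigma_tower_normal tQ; have sRG := normal_sub nRG.
have [sQR sQG] := (proper_sub pQR, normal_sub nQG).
have nQR := subset_trans sRG (normal_norm nQG).
exists t.+1, (fun i => if i <= t then S i else R); split=> //.
- by rewrite t1.
- by rewrite ltnn.
- by move=> i /andP[i1 _]; case: ifP => // le_it; apply: nS; rewrite i1.
move=> i /andP[i2]; rewrite leq_eqVlt => /predU1P[-> | ].
  rewrite /= leqnn ltnn (_ : S t = Q); last exact: val_inj.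
  split=> //; exists k0; split=> //.
  - apply: (in_sigma_dvd (dvdn_indexg R Q)) => //.
    by apply: pnat_in_sigma_gt1 kR; rewrite indexg_gt1; case/andP: pQR.
  - by rewrite /pgroup card_quotient.
  by rewrite trivg_quotient pgroup1.
rewrite ltnS => le_it; rewrite le_it (leq_trans (leq_pred i)) //.
have [|pS [k [kQ kS k'S k'QS]]] := cS i; first by rewrite i2.
split=> //; exists k; split=> //; first exact: in_sigma_dvd (cardSg sQR) _ kQ.
have nSG : S i <| G by apply: nS; rewrite le_it ltnW.
have sSQ : S i \subset Q.
  suff sSi m : i <= m <= t -> S i \subset S m by rewrite -St sSi // le_it leqnn.
  elim: m => [|m IHm] /andP[]; first by rewrite leqn0 => /eqP->.
  rewrite leq_eqVlt => /predU1P[-> // | ]; rewrite ltnS => le_im lt_mt.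
  have [|] := cS m.+1; first by rewrite lt_mt ltnS (leq_trans _ le_im) // ltnW.
  by move/proper_sub/(subset_trans (IHm _))=> ->//; rewrite le_im ltnW.
rewrite /pgroup card_quotient ?(subset_trans sRG) ?normal_norm //.
rewrite -(Lagrange_index sQR sSQ) pnatM; apply/andP; split.
  (* The block [k] meets |Q| whereas [Q] is a sigma_k0'-group, so the new layer, a sigma_k0-group,
     has order prime to sigma_k. *)
  apply: sigma_pnatC kR => // e; case: kQ => p pQ; rewrite -e.
  by move/(pnatPpi k'Q): pQ => /negP.
by rewrite -card_quotient ?(subset_trans sQG) ?normal_norm.
Qed.

(** Descend to the layer R/Q at which U/V is covered by [R] but avoided by [Q]; then |U : V| divides
    |R : Q|. *)
Lemma tower_sigma_soluble G : sigma_tower G G -> sigma_soluble sigma G.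
Proof.
move=> tG V U cfU; have [nVG nUG pVU _] := chief_factorP _ _ _ cfU.
have [sVU sUG] := (proper_sub pVU, normal_sub nUG).
have : U \subset V * G by rewrite (subset_trans sUG) ?mulG_subr.
elim: tG => [|Q R k tQ IHQ pQR nRG kR k'Q sUVR].
  by rewrite mulg1 => sUV; case/andP: pVU; rewrite sUV.
case: (chief_factor_cap cfU (sigma_tower_normal tQ)) => [sUQV | sUVQ]; last first.
  by apply: IHQ; apply: subset_trans sUVQ _; rewrite mulgS ?subsetIr.
exists k; rewrite /pgroup card_quotient ?(subset_trans sUG) ?normal_norm //.
have -> : #|U : V| = #|U :&: R : V|.
  rewrite -(indexMg V (U :&: R)); congr #|_ : _|.
  by rewrite setIC group_modl //; apply/esym/setIidPr.
have nQR : Q <| R.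
  exact: normalS (proper_sub pQR) (normal_sub nRG) (sigma_tower_normal tQ).
apply: pnat_dvd kR; apply: dvdn_trans (index_dvdn_sub (subsetIr U R) nQR).
by apply: index_dvdn_capl; rewrite setIAC (subset_trans (subsetIl _ _)).
Qed.

(** A circuit avoids the sink [k], and the blocks other than [k] meeting |R| already meet |Q|. As
    F_{sigma_i}(Q) is normal in [R], it lies in F_{sigma_i}(R), so edges between such blocks are
    edges for [Q]. *)
Lemma tower_Hawkes_no_circuit G R :
  sigma_tower G R -> ~ has_circuit (Hawkes_edge sigma R).
Proof.
elim=> [[n [v [n0 _ /(_ _ n0)]]] | {}Q {}R k tQ IHQ pQR nRG kR k'Q].
  by case=> [[p]]; rewrite cards1.
case=> n [v [n0 vn vE]]; apply: IHQ; exists n, v; split=> //.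
have sQR := proper_sub pQR.
have nQR : Q <| R.
  exact: normalS sQR (normal_sub nRG) (sigma_tower_normal tQ).
have nilR : pi_nilpotent (sigma k) R by apply/pi_nilpotentP; exists Q.
have sink j : ~ Hawkes_edge sigma R k j.
  case=> _ _ [F [nFR _ maxF] [p]].
  have -> : F = R.
    apply/val_inj/eqP; rewrite eqEsubset normal_sub //=; apply: maxF => //.
    exact/(block_nilpotentP sigmaP).
  by rewrite trivg_quotient cards1.
(* The endpoint [n] has no outgoing edge of its own; it is handled through [v n = v 0]. *)
have v_k m : m <= n -> v m <> k.
  rewrite leq_eqVlt => /predU1P[-> | lt_mn] e.
    by have:= vE 0%N n0; rewrite -vn e; exact: sink.
  by have:= vE m lt_mn; rewrite e; exact: sink.
have inQ i (H : {group gT}) : i <> k -> H \subset Q ->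
    in_sigma sigma #|R : H| i -> in_sigma sigma #|Q : H| i.
  move=> ik sHQ; rewrite -(Lagrange_index sQR sHQ) => iRH.
  case: (in_sigma_mul iRH) => // iRQ.
  by case: ik; exact: (in_sigma_pnat sigmaP kR iRQ).
move=> m lt_mn; have [iR jR [F fitF jF]] := vE m lt_mn.
have [im jm] := (v_k m (ltnW lt_mn), v_k m.+1 lt_mn).
have inQ1 i : i <> k -> in_sigma sigma #|R| i -> in_sigma sigma #|Q| i.
  by move=> ik; have:= inQ i 1%G ik (sub1G _); rewrite !indexg1.
split; [exact: inQ1 | exact: inQ1 |].
have fitF' := block_Fitting_exists sigmaP (v m) Q.
set F' := (X in is_block_Fitting _ _ _ X) in fitF'; exists F' => //.
have [nF'Q nilF' _] := fitF'.
have nF'R : F' <| R by apply: gFnormal_trans.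
have [nFR _ maxF] := fitF.
rewrite card_quotient ?normal_norm //; apply: inQ; rewrite ?normal_sub //.
rewrite card_quotient ?normal_norm // in jF.
rewrite -(Lagrange_index (normal_sub nFR) (maxF _ nF'R nilF')).
by apply: in_sigma_dvd jF; rewrite ?dvdn_mulr // muln_gt0 !indexg_gt0.
Qed.

(** Shared by both constructions of a series: the top layer is Q over O_{sigma_k'}(Q), and the order
    drops because sigma_k meets |Q|. *)
Lemma tower_ind_pcore (P : {group gT} -> Prop) G :
    (forall Q, Q :!=: 1 -> P Q -> exists k,
       [/\ in_sigma sigma #|Q| k, pi_nilpotent (sigma k) Q
          & P 'O_(sigma k)^'(Q)%G]) ->
  P G -> sigma_tower G G.
Proof.
move=> stepP; suff: forall Q, Q <| G -> P Q -> sigma_tower G Q.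
  by apply; exact: normal_refl.
move=> Q; have [n] := ubnP #|Q|; elim: n Q => // n IHn Q leQn nQG PQ.
have [Q1 | ntQ] := eqVneq (Q :>{set gT}) 1.
  by have -> : Q = 1%G; [exact: val_inj | exact: SigmaTower1].
have [k [kQ nilQ PO]] := stepP Q ntQ PQ.
have pOQ : 'O_(sigma k)^'(Q) \proper Q.
  rewrite properEneq pcore_sub andbT; apply/eqP=> eOQ.
  have := pcore_pgroup (sigma k)^' Q; rewrite eOQ => k'Q.
  by case: kQ => p /(pnatPpi k'Q)/negP.
have k'O := pcore_pgroup (sigma k)^' Q.
apply: (SigmaTowerS (IHn 'O_(sigma k)^'(Q)%G _ _ PO) pOQ nQG nilQ k'O).
  exact: leq_trans (proper_card pOQ) _.
exact: gFnormal_trans.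
Qed.

End Towers.

(** * Sigma-soluble groups controlled by their critical subgroups *)

Section Critical.

Variables (I : Type) (sigma : I -> nat_pred).
Hypothesis sigmaP : prime_partition sigma.
Variable gT : finGroupType.
Implicit Types G H K L N M U V P Q R : {group gT}.

Lemma block_Fitting_sink k G F :
    is_block_Fitting sigma k G F -> (forall j, ~ in_sigma sigma #|G / F| j) ->
  pi_nilpotent (sigma k) G.
Proof.
case=> nFG nilF _ sink; suff defG : F :=: G.
  by rewrite -[G](val_inj defG); exact/(block_nilpotentP sigmaP).
apply/eqP; rewrite eqEsubset normal_sub //= -indexg_eq1.
rewrite -card_quotient ?normal_norm // eqn_leq cardG_gt0 andbT leqNgt.
apply/negP=> gt1; have [j pj] := sigma_cover sigmaP (pdiv_prime gt1).
by apply: (sink j); exists (pdiv #|G / F|); rewrite ?pi_pdiv.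
Qed.

(* A form of sigma-solubility that subgroups inherit by definition. *)
Definition sigma_top_factors G :=
  forall H, H \subset G -> H :!=: 1 ->
  exists j M, [/\ M <| H, M \proper H & (sigma j).-nat #|H : M|].

Lemma sigma_top_factorsS G H :
  H \subset G -> sigma_top_factors G -> sigma_top_factors H.
Proof. by move=> sHG topG K sKH; apply: topG; exact: subset_trans sHG. Qed.

(** Take [N] maximal among the normal subgroups of [G] not containing [H]. A chief factor U/N then
    has [H] inside [U], and |H : H :&: N| divides |U : N|. *)
Lemma sigma_soluble_top_factors G : sigma_soluble sigma G -> sigma_top_factors G.
Proof.
move=> solG H sHG ntH.
have P1 : (1%G <| G) && ~~ (H \subset 1%G) by rewrite normal1 subG1.
have [N /maxgroupP[/andP[nNG sHN] maxN] _] :=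
  maxgroup_exists (gP := fun N : {group gT} => (N <| G) && ~~ (H \subset N)) P1.
have pNG : N \proper G.
  by rewrite /proper normal_sub //; apply: contra sHN; exact: subset_trans.
have [U cfU] := chief_factor_above nNG pNG.
have [_ nUG pNU _] := chief_factorP _ _ _ cfU.
have sHU : H \subset U.
  apply: contraTT (pNU) => NsHU; rewrite (_ : U :=: N) ?properxx //.
  by apply: maxN; rewrite ?nUG // proper_sub.
have nNU : N <| U by exact: normalS (proper_sub pNU) (normal_sub nUG) nNG.
have [j jU] := solG _ _ cfU; exists j, (H :&: N)%G; split.
- exact: normalGI nNG.
- by rewrite properEneq subsetIl andbT; apply: contra sHN => /eqP/setIidPl.
rewrite indexgI; apply: pnat_dvd (index_dvdn_sub sHU nNU) _.
by rewrite -card_quotient ?normal_norm.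
Qed.

(* The key point: R = O_{sigma_k'}(M) has no proper supplement in a minimal
   counterexample, so it is nilpotent and the conjugacy part of
   Schur-Zassenhaus is available without the odd order theorem. *)
Lemma sigma_critical_pi_nilpotent k G :
    sigma_top_factors G ->
    (forall H, H \subset G -> sigma_nilpotent_critical sigma H ->
       pi_nilpotent (sigma k) H) ->
  pi_nilpotent (sigma k) G.
Proof.
have [n] := ubnP #|G|; elim: n G => // n IHn G leGn topG critG.
apply/negPn/negP=> NnilG.
have nilS H : H \proper G -> pi_nilpotent (sigma k) H.
  move=> pHG; have sHG := proper_sub pHG.
  apply: IHn; first exact: leq_trans (proper_card pHG) _.
    exact: sigma_top_factorsS topG.
  by move=> K sKH; apply: critG; exact: subset_trans sHG.
have [G1 | ntG] := eqVneq (G :> {set gT}) 1.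
  case/negP: NnilG; apply/pi_nilpotentP; exists 1%G.
  by rewrite normal1 indexg1 G1 cards1 pgroup1.
have [j [M [nMG pMG jGM]]] := topG G (subxx _) ntG.
have sMG := proper_sub pMG.
(* Otherwise O_{sigma_k'}(M) would be a normal Hall sigma_k'-subgroup of [G] itself. *)
have neq_jk : j <> k.
  move=> ejk; case/negP: NnilG; apply/pi_nilpotentP.
  exists 'O_(sigma k)^'(M)%G; split; [exact: gFnormal_trans | exact: pcore_pgroup |].
  by rewrite -(Lagrange_index sMG (pcore_sub _ _)) pnatM -{1}ejk jGM; exact: nilS.
set R := 'O_(sigma k)^'(M)%G.
have nRG : R <| G by exact: gFnormal_trans.
have [nRM k'R kMR] : [/\ R <| M, (sigma k)^'.-group R & (sigma k).-nat #|M : R|].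
  by split; [exact: pcore_normal | exact: pcore_pgroup | exact: nilS].
have [sRM sRG] := (normal_sub nRM, normal_sub nRG).
have suppR L : L \subset G -> R * L = G -> L :=: G.
  move=> sLG defG; apply/eqP/negPn/negP=> neLG; case/negP: NnilG.
  apply: (pi_nilpotent_pi'mul nRG k'R defG); apply: nilS.
  by rewrite properEneq neLG.
have normR P : P \subset G -> R * 'N_G(P) = G -> P <| G.
  move=> sPG /(suppR _ (subsetIl _ _)) defG.
  by rewrite /normal sPG // -{1}defG subsetIr.
(* By the Frattini argument and [normR], every Sylow subgroup of [R] is normal in [G], so it lies in
   the Fitting subgroup of [R]. *)
have nilR : nilpotent R.
  apply: nilpotentS (Fitting_nil R); rewrite -indexg_eq1.
  have [// | i1] := eqVneq #|R : 'F(R)| 1%N.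
  have p_pr : prime (pdiv #|R : 'F(R)|).
    by rewrite pdiv_prime // ltn_neqAle eq_sym i1 indexg_gt0.
  have [P sylP] := Sylow_exists (pdiv #|R : 'F(R)|) R.
  have sPR := pHall_sub sylP.
  have sPF : P \subset 'F(R).
    apply: Fitting_max; last exact: pgroup_nil (pHall_pgroup sylP).
    apply: (normalS sPR sRG); apply: (normR P (subset_trans sPR sRG)).
    exact: Frattini_arg nRG sylP.
  have [_ _] := and3P sylP.
  rewrite p'natE // => /negP[]; apply: dvdn_trans (pdiv_dvd _) _.
  exact: indexgS.
have hR : Hall M R.
  by rewrite /Hall sRM coprime_sym (pnat_coprime kMR).
have /splitsP[P /complP[tiRP defM]] := SchurZassenhaus_split hR nRM.
have sPM : P \subset M by rewrite -defM mulG_subr.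
have cM : #|M| = (#|R| * #|P|)%N by rewrite -defM TI_cardMg.
have kP : (sigma k).-group P.
  by rewrite /pgroup -(mulKn #|P| (cardG_gt0 R)) -cM divgS.
(* Every [G]-conjugate of [P] is a complement of [R] in [M], hence an [R]-conjugate of [P]; this
   gives R * N_G(P) = G. *)
have nPG : P <| G.
  apply: normR (subset_trans sPM sMG) _.
  apply/eqP; rewrite eqEsubset mul_subG ?subsetIl //=; apply/subsetP=> g Gg.
  have sPgM : P :^ g \subset R * P.
    by rewrite defM -(normsP (normal_norm nMG) g Gg) conjSg.
  have [|||x Rx defPg] := SchurZassenhaus_trans_sol (nilpotent_sol nilR) _ sPgM.
  - by rewrite (subset_trans sPM) ?normal_norm.
  - by rewrite coprime_sym (pnat_coprime kP).
  - by rewrite cardJg.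
  rewrite -normC; last by rewrite (subset_trans (subsetIl _ _)) ?normal_norm.
  have -> : g = (g * x^-1) * x by rewrite mulgKV.
  apply: mem_mulg => //; rewrite inE groupM ?groupV ?(subsetP sRG x Rx) //=.
  by apply/normP; rewrite conjsgM defPg conjsgK.
(* The sigma_j'-part [R'] of [R] is a normal Hall subgroup of [G]. A complement of it supplements
   [R], so it equals [G] and [R'] is trivial. *)
have jR : (sigma j).-group R.
  set R' := 'O_(sigma j)^'(R)%G.
  have hallR' : (sigma j)^'.-Hall(R) R' by exact: nilpotent_pcore_Hall.
  have nR'G : R' <| G by exact: gFnormal_trans.
  have sR'R : R' \subset R by exact: pcore_sub.
  have hGR' : Hall G R'.
    rewrite /Hall normal_sub //= -(Lagrange_index sMG (subset_trans sR'R sRM)).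
    rewrite -(Lagrange_index sRM sR'R) !coprimeMr; apply/and3P.
    have j'R' : (sigma j)^'.-group R' by exact: pcore_pgroup.
    split; first by rewrite coprime_sym (pnat_coprime jGM).
      by rewrite coprime_sym (pnat_coprime kMR (pgroupS sR'R k'R)).
    have [_ _ jRR'] := and3P hallR'.
    by rewrite (pnat_coprime j'R').
  have /splitsP[L /complP[tiR'L defG]] := SchurZassenhaus_split hGR' nR'G.
  have sLG : L \subset G by rewrite -defG mulG_subr.
  have defL : L :=: G.
    apply: suppR => //; apply/eqP; rewrite eqEsubset mul_subG //=.
    by rewrite -{1}defG mulSg.
  have R'1 : #|R'| = 1%N.
    by rewrite -(setIidPl (normal_sub nR'G)) -defL tiR'L cards1.
  have [_ _] := and3P hallR'.
  rewrite /pgroup -divgS //= R'1 divn1; apply: sub_in_pnat => p _.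
  by rewrite !inE negbK.
have jGP : (sigma j).-nat #|G : P|.
  rewrite -(Lagrange_index sMG sPM) pnatM jGM -divgS // cM mulnK //.
case/negP: (NnilG); apply: critG => //; split.
  move=> nilG; case/negP: NnilG; apply/(block_nilpotentP sigmaP) => V U cfU _.
  exact: nilG.
(* For primes in sigma_k use minimality; the others dividing |G| lie in sigma_j, and [P] is a normal
   Hall sigma_j'-subgroup of [G]. *)
move=> H pHG; apply: (sigma_nilpotentP sigmaP) => p pH.
have sHG := proper_sub pHG.
have : p \in \pi(#|G|) by apply: (pi_of_dvd (cardSg sHG) _ pH).
rewrite -(Lagrange (normal_sub nPG)) pi_ofM // inE => /orP[pP | pGP].
  by exists k; [exact: pnatPpi kP pP | exact: nilS].
exists j; first exact: pnatPpi jGP pGP.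
apply: (pi_nilpotentS sHG); apply/pi_nilpotentP; exists P; split=> //.
exact: (sigma_pnatC sigmaP (nesym neq_jk) kP).
Qed.

End Critical.

Theorem theorem1p4 (I : Type) (sigma : I -> nat_pred)
    (sigmaP : prime_partition sigma)
    (gT : finGroupType) (G : {group gT}) (ntG : G :!=: 1) :
  [<-> has_sigma_series sigma G;
       ~ has_circuit (Hawkes_edge sigma G);
       sigma_soluble sigma G
         /\ ~ has_circuit (Vasilev_Murashko_edge sigma G)].
Proof.
have circuitS (E E' : I -> I -> Prop) :
    (forall i j, E i j -> E' i j) -> ~ has_circuit E' -> ~ has_circuit E.
  move=> sEE' NE' [n [v [n0 vn vE]]]; apply: NE'; exists n, v; split=> // k lt_kn.
  exact/sEE'/vE.
(* Proved apart from the cycle because the second condition must yield sigma-solubility, which is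
   read off a tower. *)
have Hawkes_tower : ~ has_circuit (Hawkes_edge sigma G) -> sigma_tower sigma G G.
  pose P (Q : {group gT}) := ~ has_circuit (Hawkes_edge sigma Q).
  apply: (tower_ind_pcore (P := P)) => Q ntQ Ncirc.
  have [||k kQ sink] := no_circuit_sink sigmaP _ _ Ncirc (n := #|Q|).
  - by rewrite cardG_gt1.
  - by move=> i j [].
  exists k; split=> //; last first.
    apply: circuitS Ncirc => i j; apply: (Hawkes_edge_sub sigmaP).
    exact: pcore_sub.
  have fitQ := block_Fitting_exists sigmaP k Q.
  apply: (block_Fitting_sink sigmaP fitQ) => j jQF; apply: (sink j); split=> //.
    apply: in_sigma_dvd jQF => //; rewrite card_quotient ?dvdn_indexg //.
    by case: fitQ => /normal_norm.
  by exists 'O_{(sigma k)^', sigma k}(Q)%G.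
tfae=> [serG | Ncirc | [solG Ncirc]].
- exact: tower_Hawkes_no_circuit (series_tower serG).
- split; first exact/tower_sigma_soluble/Hawkes_tower.
  by apply: circuitS Ncirc => i j; exact: Vasilev_Murashko_Hawkes_edge.
apply: tower_series => //.
apply: (tower_ind_pcore (P := fun Q => sigma_top_factors sigma Q
          /\ ~ has_circuit (Vasilev_Murashko_edge sigma Q))).
  move=> Q ntQ [topQ NcircQ].
  have [||k kQ sink] := no_circuit_sink sigmaP _ _ NcircQ (n := #|Q|).
  - by rewrite cardG_gt1.
  - by move=> i j [].
  exists k; split=> //; last first.
    split; first by apply: sigma_top_factorsS topQ; exact: pcore_sub.
    apply: circuitS NcircQ => i j; apply: Vasilev_Murashko_edge_sub.
    exact: pcore_sub.
  apply: (sigma_critical_pi_nilpotent sigmaP) => // H sHQ critH.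
  (* An edge leaving [k] through [H] requires sigma_k to meet |H|; if it does not, [H] is a
     sigma_k'-group and its own Hall subgroup. *)
  have [kH | NkH] := classic (in_sigma sigma #|H| k); last first.
    apply/pi_nilpotentP; exists H; rewrite normal_refl indexgg /pgroup.
    by rewrite pnat_in_sigma.
  have fitH := block_Fitting_exists sigmaP k H.
  apply: (block_Fitting_sink sigmaP fitH) => j jHF; apply: (sink j); split=> //.
    apply: in_sigma_dvd (cardSg sHQ) _ _ => //; apply: in_sigma_dvd jHF => //.
    rewrite card_quotient ?dvdn_indexg //; by case: fitH => /normal_norm.
  by exists H; split=> //; exists 'O_{(sigma k)^', sigma k}(H)%G.
by split; first exact: sigma_soluble_top_factors.
Qed.
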